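(* Let $V$ and $W$ be linear subspaces of a locality vector space $(E,\top)$ over $\mathbb{K}$, let $(G,\top_G)$ be a locality vector space and let $f:(V\times_\top W,\top_{V\times_\top W})\to(G,\top_G)$ be a locality $\top_\times$-bilinear map. Assume that the subspace $I_{\rm bil}(V,W)\cap\mathbb{K}(V\times_\top W)\subset\mathbb{K}(V\times_\top W)$ is locality compatible with $\top_{V\times_\top W}$. Then there is a unique locality linear map $\phi:(V\otimes_\top W,\top_\otimes)\to(G,\top_G)$ such that $f=\phi\circ\otimes_\top$.
   Context: $\mathbb{K}$ is $\mathbb{R}$ or $\mathbb{C}$. A locality vector space is a vector space $E$ with a symmetric relation $\top\subset E\times E$ containing $(0,0)$ such that for every $U\subset E$ the polar set $U^\top=\{x: x\top u\ \forall u\in U\}$ is a linear subspace. A locality map sends related pairs to related pairs; a locality linear map is a linear locality map. A subspace $W'$ of a locality vector space $(V',\top')$ is locality compatible with $\top'$ if for all $x,y,z\in V'$ and $w\in W'$ with $x\top'y$ and $(x+w)\top'z$, there is $w'\in W'$ with $(x+w')\top'y$ and $(x+w')\top'z$. $V\times_\top W:=\top\cap(V\times W)$. $\mathbb{K}(X)$ is the free vector space on $X$. $I_{\rm bil}(V,W)\subset\mathbb{K}(V\times W)$ is spanned by all $(a+b,x)-(a,x)-(b,x)$, $(a,x+y)-(a,x)-(a,y)$, $(ka,x)-k(a,x)$, $(a,kx)-k(a,x)$ with $a,b\in V$, $x,y\in W$, $k\in\mathbb{K}$. $V\otimes_\top W:=\mathbb{K}(V\times_\top W)/(I_{\rm bil}(V,W)\cap\mathbb{K}(V\times_\top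 W))$, and $\otimes_\top:V\times_\top W\to V\otimes_\top W$ is $(v,w)\mapsto[(v,w)]$. The relation $\top_{V\times_\top W}$ on $V\times_\top W$ relates $(v,w)$ and $(v',w')$ iff $v\top v'$ and $w\top w'$; it is extended to $\mathbb{K}(V\times_\top W)$ (same notation): two elements are related iff all basis elements with nonzero coefficient in the first are related to all those in the second. Two classes in $V\otimes_\top W$ are $\top_\otimes$-related iff they have related representatives. A map $f:V\times_\top W\to G$ is locality $\top_\times$-bilinear if its linear extension to $\mathbb{K}(V\times_\top W)$ vanishes on $I_{\rm bil}(V,W)\cap\mathbb{K}(V\times_\top W)$ and $f$ is a locality map from $(V\times_\top W,\top_{V\times_\top W})$ to $(G,\top_G)$. *)

(* Defs.v *)
From HB Require Import structures.
From mathcomp Require Import all_boot all_algebra ring_quotient.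
From mathcomp Require Import boolp classical_sets reals complex freeg.

Set Implicit Arguments.
Unset Strict Implicit.
Unset Printing Implicit Defensive.

Import GRing.Theory.

Local Open Scope ring_scope.
Local Open Scope classical_set_scope.
Local Open Scope quotient_scope.

(* [submodClosed F] bundles a subspace of F as a boolean predicate; [subsp A]
   is that subspace as a vector space in its own right. *)
Section Subspace.
Variables (K : fieldType) (F : lmodType K) (A : submodClosed F).

Record subsp := Subsp { subsp_val : F; _ : subsp_val \in A }.

HB.instance Definition _ := [isSub for subsp_val].
HB.instance Definition _ := [Choice of subsp by <:].
HB.instance Definition _ := [SubChoice_isSubLmodule of subsp by <:].

End Subspace.

(* ring_quotient only equips the quotient with its additive structure. *)
Section QuotientSpace.
Variables (K : fieldType) (F : lmodType K) (A : submodClosed F).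

(* The structure of submodClosed contains no opposite, hence the repackaging. *)
Definition submod_zmod : zmodClosed F := HB.pack_for (zmodClosed F)
  (GRing.SubmodClosed.sort A)
  (GRing.isZmodClosed.Build F _ (GRing.submod_closedB (submodClosedP A))).

Definition quotsp := Quotient.quot submod_zmod.

HB.instance Definition _ := GRing.Zmodule.on quotsp.
HB.instance Definition _ := ZmodQuotient.on quotsp.

Definition quotsp_scale (k : K) (x : quotsp) : quotsp :=
  \pi_quotsp (k *: repr x).

Lemma quotsp_eqE x y : (\pi_quotsp x == \pi_quotsp y) = (x - y \in A).
Proof. by rewrite -(Quotient.idealrBE submod_zmod). Qed.

Lemma quotsp_scaleE k (x : F) :
  quotsp_scale k (\pi_quotsp x) = \pi_quotsp (k *: x).
Proof.
apply/eqP; rewrite quotsp_eqE -scalerBr; apply: rpredZ.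
by rewrite -quotsp_eqE reprK.
Qed.

Lemma quotsp_scaleA a b x :
  quotsp_scale a (quotsp_scale b x) = quotsp_scale (a * b) x.
Proof. by rewrite -[x]reprK (quotsp_scaleE b) !quotsp_scaleE scalerA. Qed.

Lemma quotsp_scale1 : left_id 1 quotsp_scale.
Proof. by move=> x; rewrite -[x]reprK quotsp_scaleE scale1r. Qed.

Lemma quotsp_scaleDr : right_distributive quotsp_scale +%R.
Proof.
move=> a x y; rewrite -[x]reprK -[y]reprK.
by rewrite -raddfD !quotsp_scaleE scalerDr raddfD.
Qed.

Lemma quotsp_scaleDl x : {morph quotsp_scale^~ x : a b / a + b}.
Proof.
move=> a b; rewrite -[x]reprK.
by rewrite !quotsp_scaleE -raddfD scalerDl.
Qed.

HB.instance Definition _ := GRing.Zmodule_isLmodule.Build K quotsp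
  quotsp_scaleA quotsp_scale1 quotsp_scaleDr quotsp_scaleDl.

End QuotientSpace.

Section Span.
Variables (K : fieldType) (F : lmodType K).

Definition spanned (S : set F) : set F :=
  [set z | exists2 s : seq (K * F),
     (forall c, c \in s -> S c.2) & z = \sum_(c <- s) c.1 *: c.2].

Lemma spanned_submod (S : set F) :
  submod_closed (fun z => `[< spanned S z >]).
Proof.
split; first by apply/asboolP; exists [::]; rewrite ?big_nil.
move=> a u v /asboolP[s sS ->] /asboolP[t tS ->]; apply/asboolP.
exists ([seq (a * c.1, c.2) | c <- s] ++ t) => [c|].
  by rewrite mem_cat => /orP[/mapP[d /sS ? ->]//|/tS].
rewrite big_cat big_map /= scaler_sumr.
by congr (_ + _); apply: eq_bigr => c _; rewrite scalerA.
Qed.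

End Span.

Section FreegLiftLinear.
Variables (K : fieldType) (X : choiceType) (F : lmodType K) (f : X -> F).

HB.instance Definition _ :=
  GRing.isZmodMorphism.Build {freeg X / K} F (fglift f) (lift_is_additive f).

Lemma fglift_scalable : scalable (fglift f : {freeg X / K} -> F).
Proof.
move=> k x; rewrite -[x]freeg_sumE [in RHS]raddf_sum !scaler_sumr raddf_sum.
apply: eq_bigr => z _; rewrite -[in LHS](_ : << k * coeff z x *g z >> = k *: << coeff z x *g z >>).
  by rewrite /= !liftU scalerA.
by apply/eqP/freeg_eqP => y; rewrite coeffZ !coeffU mulrA.
Qed.

HB.instance Definition _ :=
  GRing.isScalable.Build K {freeg X / K} F *:%R (fglift f) fglift_scalable.

End FreegLiftLinear.

Definition locality_map (A B : Type) (topA : A -> A -> Prop)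
    (topB : B -> B -> Prop) (f : A -> B) : Prop :=
  forall x y, topA x y -> topB (f x) (f y).

Section LocalitySpace.
Variables (K : fieldType) (E : lmodType K) (top : E -> E -> Prop).

Definition polar (U : set E) : set E :=
  [set x | forall u, U u -> top x u].

Definition locality_space : Prop :=
  [/\ forall x y, top x y -> top y x,
      top 0 0
    & forall U : set E, submod_closed [pred x in polar U]].

Definition locality_compatible (A : submodClosed E) : Prop :=
  forall x y z w : E, w \in A -> top x y -> top (x + w) z ->
  exists2 w', w' \in A & top (x + w') y /\ top (x + w') z.

End LocalitySpace.

Section LocalityTensor.
Variables (K : fieldType) (E : lmodType K) (top : E -> E -> Prop).
Variables V W : submodClosed E.

Definition loc_prod :=
  {p : subsp V * subsp W | `[< top (val p.1) (val p.2) >]}.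

Definition top_prod (p q : loc_prod) : Prop :=
  top (val (val p).1) (val (val q).1) /\ top (val (val p).2) (val (val q).2).

Definition freeVW := {freeg (subsp V * subsp W)%type / K}.
Definition free_top := {freeg loc_prod / K}.

HB.instance Definition _ := GRing.Lmodule.on freeVW.
HB.instance Definition _ := GRing.Lmodule.on free_top.

Definition gen (v : subsp V) (w : subsp W) : freeVW := << (v, w) >>.

Variant bil_gen : set freeVW :=
  | BilAddl a b x : bil_gen (gen (a + b) x - gen a x - gen b x)
  | BilAddr a x y : bil_gen (gen a (x + y) - gen a x - gen a y)
  | BilScalel k a x : bil_gen (gen (k *: a) x - k *: gen a x)
  | BilScaler k a x : bil_gen (gen a (k *: x) - k *: gen a x).

Definition Ibil : set freeVW := spanned bil_gen.

(* The embedding induced by loc_prod being a subset of V * W; it is injective. *)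
Definition free_incl (z : free_top) : freeVW :=
  fglift (fun p : loc_prod => << val p >> : freeVW) z.

(* The intersection of Ibil with the free space on loc_prod, as a subspace of
   the latter. *)
Definition Ibil_top : {pred free_top} :=
  fun z => `[< Ibil (free_incl z) >].

Lemma Ibil_top_submod : submod_closed Ibil_top.
Proof.
have [I0 IL] := spanned_submod bil_gen.
split=> [|k u v Iu Iv]; rewrite unfold_in /Ibil_top /free_incl.
  by rewrite raddf0.
by rewrite linearP; apply: IL.
Qed.

HB.instance Definition _ := GRing.isSubmodClosed.Build K free_top Ibil_top
  Ibil_top_submod.

Definition top_free (x y : free_top) : Prop :=
  forall p q, p \in dom x -> q \in dom y -> top_prod p q.

Definition loc_tensor := quotsp Ibil_top.

HB.instance Definition _ := GRing.Lmodule.on loc_tensor.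

Definition tensor (p : loc_prod) : loc_tensor := \pi_loc_tensor (<< p >>).

Definition top_tensor (a b : loc_tensor) : Prop :=
  exists x y : free_top,
    [/\ a = \pi_loc_tensor x, b = \pi_loc_tensor y & top_free x y].

Definition locality_bilinear (G : lmodType K) (topG : G -> G -> Prop)
    (f : loc_prod -> G) : Prop :=
  (forall z : free_top, z \in Ibil_top -> fglift f z = 0) /\
  locality_map top_prod topG f.

End LocalityTensor.

Arguments Ibil_top {K E} top V W.
Arguments top_free {K E} top V W.
Arguments tensor {K E} top V W.
Arguments top_tensor {K E} top V W.

(* Main.v *)
Require Import Defs.
From mathcomp Require Import all_boot all_algebra reals complex.
From HB Require Import structures.
From mathcomp Require Import ring_quotient boolp classical_sets freeg.

Local Open Scope ring_scope.

(** The linear extension of [f] to the free space vanishes on [Ibil_top], so it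
    descends to a linear map on the quotient [loc_tensor]; it is the only one
    extending [f], because a linear map on a free space is determined by its
    values on the basis ([linear_fgliftE]).

    The descended map is a locality map because it can be evaluated on any
    representatives: two [top_tensor]-related classes have [top_free]-related
    ones, whose basis elements [f] sends to pairwise related vectors. The polars
    of [topG] are subspaces, so this relation passes to linear combinations in
    one argument, then by symmetry in the other ([locality_fglift]). *)

Import GRing.Theory.

Set Implicit Arguments.
Unset Strict Implicit.
Unset Printing Implicit Defensive.

(** * Locality and linear combinations *)

(** The polar of the singleton [y] is a subspace. In particular it contains
    [0], which settles the empty sum: a locality space relates [0] to every
    vector. *)
Lemma locality_suml (K : fieldType) (G : lmodType K) (topG : G -> G -> Prop)
    (HG : locality_space topG) (I : eqType) (s : seq I) (c : I -> K)
    (F : I -> G) (y : G) :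
    (forall i, i \in s -> topG (F i) y) ->
  topG (\sum_(i <- s) c i *: F i) y.
Proof.
case: HG => _ _ /(_ [set y]%classic)[P0 PL] Fy.
have polarE x : (x \in [pred x in polar topG [set y]%classic]) <-> topG x y.
  by rewrite !inE /polar /=; split=> [|xy u ->//]; apply.
apply/polarE; rewrite big_seq; elim/big_ind : _ => [//|u v Pu Pv|i si].
  by rewrite -[u]scale1r; apply: PL.
by rewrite -[_ *: _]addr0; apply: PL => //; apply/polarE/Fy.
Qed.

Lemma fglift_sumE (K : fieldType) (X : choiceType) (G : lmodType K)
    (f : X -> G) (x : {freeg X / K}) :
  fglift f x = \sum_(p <- dom x) coeff p x *: f p.
Proof.
rewrite -[x in LHS]freeg_sumE raddf_sum.
by apply: eq_bigr => p _; rewrite /= liftU.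
Qed.

(** Both arguments are sums over their domains, and relatedness is linear in
    each of them separately. *)
Lemma locality_fglift (K : fieldType) (X : choiceType) (G : lmodType K)
    (topG : G -> G -> Prop) (HG : locality_space topG)
    (r : X -> X -> Prop) (f : X -> G) (Hf : locality_map r topG f)
    (x y : {freeg X / K}) :
    (forall p q, p \in dom x -> q \in dom y -> r p q) ->
  topG (fglift f x) (fglift f y).
Proof.
have [symG _ _] := HG.
move=> xy; rewrite !fglift_sumE; apply: (locality_suml HG) => p px.
apply: (symG); apply: (locality_suml HG) => q qy.
by apply: (symG); apply: Hf; apply: xy.
Qed.

(** * Linear maps on free spaces and on quotients *)

Lemma linear_fgliftE (K : fieldType) (X : choiceType) (G : lmodType K)
    (g : {linear {freeg X / K} -> G}) (x : {freeg X / K}) :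
  g x = fglift (fun p => g << p >>) x.
Proof.
rewrite fglift_sumE -[x in LHS]freeg_sumE linear_sum.
apply: eq_bigr => p _; rewrite -linearZ; congr (g _).
by apply/eqP/freeg_eqP => q; rewrite coeffZ !coeffU mul1r.
Qed.

Section QuotientLift.
Variables (K : fieldType) (F : lmodType K) (A : submodClosed F).
Variables (G : lmodType K) (g : {linear F -> G}).
Hypothesis g0 : forall z, z \in A -> g z = 0.

Lemma quotsp_pi_linear : linear (fun x : F => \pi_(quotsp A) x)%qT.
Proof. by move=> k x y; rewrite raddfD /= -quotsp_scaleE. Qed.

Definition quotsp_lift (q : quotsp A) : G := g (repr q).

(** The chosen representative of the class of [x] differs from [x] by an
    element of [A], where [g] vanishes. *)
Lemma quotsp_liftE x : quotsp_lift (\pi_(quotsp A) x)%qT = g x.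
Proof. by apply/subr0_eq; rewrite /quotsp_lift -linearB g0// -quotsp_eqE reprK. Qed.

Lemma quotsp_lift_linear : linear quotsp_lift.
Proof.
move=> k x y; rewrite -[x]reprK -[y]reprK -quotsp_pi_linear.
by rewrite !quotsp_liftE linearP.
Qed.

End QuotientLift.

(** * The universal property *)

Theorem theorem7p4 (R : realType) (K : fieldType)
  (HK : K = (R : fieldType) \/ K = (R[i] : fieldType))
  (E : lmodType K) (top : E -> E -> Prop) (HE : locality_space top)
  (V W : submodClosed E)
  (G : lmodType K) (topG : G -> G -> Prop) (HG : locality_space topG)
  (f : loc_prod top V W -> G) (Hf : locality_bilinear topG f)
  (Hcompat : locality_compatible (top_free top V W) (Ibil_top top V W)) :
  exists! phi : loc_tensor top V W -> G,
    [/\ linear phi,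
        locality_map (top_tensor top V W) topG phi
      & f = phi \o tensor top V W].
Proof.
case: Hf => f0 f_loc.
pose phi : loc_tensor top V W -> G :=
  quotsp_lift (A := Ibil_top top V W) (fglift f).
have phiE x : phi (\pi_(loc_tensor top V W) x)%qT = fglift f x.
  exact: quotsp_liftE.
exists phi; split; first split.
- exact: quotsp_lift_linear.
- move=> _ _ [x [y [-> -> xy]]]; rewrite !phiE.
  exact: (locality_fglift HG f_loc).
- by apply/funext => p; rewrite /= phiE liftU scale1r.
move=> psi [psi_lin _ fE]; apply/funext => a; rewrite -[a]reprK phiE fE.
pose g (x : free_top top V W) := psi (\pi_(loc_tensor top V W) x)%qT.
have g_lin : linear g.
  by move=> k x y; rewrite /g quotsp_pi_linear psi_lin.
pose gL : {linear free_top top V W -> G} :=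
  HB.pack g (GRing.isLinear.Build K (free_top top V W) G *:%R g g_lin).
exact/esym/(linear_fgliftE gL).
Qed.
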